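(* Consider the control system $y'(t)=f(y(t),u(t))$, $u(t)\in U$, the compact state constraint set $Y\subset\mathbb{R}^m$ on which the system is viable, the running cost $k$, the optimal values $V_T(y_0)$, $h_\lambda(y_0)$, and the dual optimal value $d^*(y_0)$ defined in the context. Then for every $y_0\in Y$ $$\liminf_{T\to\infty}V_T(y_0)\ge d^*(y_0)\qquad\text{and}\qquad \liminf_{\lambda\downarrow0}h_\lambda(y_0)\ge d^*(y_0).$$
   Context: Setting. $U$ is a compact metric space; $f:\mathbb{R}^m\times U\to\mathbb{R}^m$ is continuous and Lipschitz in $y$ uniformly in $u\in U$; $k:\mathbb{R}^m\times U\to\mathbb{R}$ is continuous. $\mathcal{U}$ is the set of measurable functions $u:[0,\infty)\to U$, and $y(\cdot,y_0,u)$ is the solution of $y'(t)=f(y(t),u(t))$, $y(0)=y_0$. $Y\subset\mathbb{R}^m$ is a nonempty compact set equal to the closure of its interior. $\mathcal{U}_T(y_0)$ (resp. $\mathcal{U}(y_0)$) is the set of $u\in\mathcal{U}$ with $y(t,y_0,u)\in Y$ for all $t\in[0,T]$ (resp. all $t\ge 0$). Standing assumption (viability): $\mathcal{U}(y_0)\ne\emptyset$ for every $y_0\in Y$. Optimal values: for $T,\lambda>0$, $$V_T(y_0)=\frac1T\inf_{u\in\mathcal{U}_T(y_0)}\int_0^T k(y(t,y_0,u),u(t))\,dt,\qquad h_\lambda(y_0)=\lambda\inf_{u\in\mathcal{U}(y_0)}\int_0^\infty e^{-\lambda t}k(y(t,y_0,u),u(t))\,dt.$$ Dual problem. $C^1$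 is the space of continuously differentiable functions $\mathbb{R}^m\to\mathbb{R}$; gradients are row vectors. $d^*(y_0)$ is the supremum of $\mu$ over all triplets $(\mu,\psi,\eta)\in\mathbb{R}\times C^1\times C^1$ such that for all $(y,u)\in Y\times U$ $$k(y,u)+(\psi(y_0)-\psi(y))+\nabla\eta(y)f(y,u)-\mu\ge0,\qquad \nabla\psi(y)f(y,u)\ge0.$$ *)

(* Defs.v *)
From HB Require Import structures.
From mathcomp Require Import all_boot all_order all_algebra.
From mathcomp Require Import all_classical all_reals all_analysis.

Set Implicit Arguments.
Unset Strict Implicit.
Unset Printing Implicit Defensive.

Import Order.TTheory GRing.Theory Num.Theory.
Import numFieldNormedType.Exports.

Local Open Scope classical_set_scope.
Local Open Scope ring_scope.

(* [R] with the sigma-algebra of Lebesgue (not only Borel) measurable sets; it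
   is the domain of [completed_lebesgue_measure]. *)
Notation lebesgueType R :=
  (caratheodory_type ((@wlength R idfun)^*)%mu).

Notation leb := completed_lebesgue_measure.

Section control_system.
Context {R : realType} {m : nat} {U : metricType R}.
Implicit Types (f : 'cV[R]_m -> U -> 'cV[R]_m) (k : 'cV[R]_m -> U -> R).
Implicit Types (Y : set 'cV[R]_m).
Implicit Types (u : R -> U) (y : R -> 'cV[R]_m).

(* Controls and trajectories are functions on [0, +oo[, represented by functions
   on [R] whose values at negative times are never used. Measurability is with
   respect to the Borel sets of [U], hence is tested on open sets. *)
Definition control u : Prop :=
  forall O : set U, open O ->
    measurable (`[0, +oo[%classic `&` u @^-1` O : set (lebesgueType R)).

(* As [u] is only measurable, y' = f(y, u), y(0) = y0 is understood in the sense
   of Caratheodory: y is continuous and satisfies the integral equation. *)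
Definition solution f (y0 : 'cV[R]_m) u y : Prop :=
  {within `[0, +oo[, continuous y} /\
  forall t : R, 0 <= t -> forall i : 'I_m,
    y t i 0 = y0 i 0 + \int[leb]_(s in `[0, t]) (f (y s) (u s) i 0).

(* The pairs (u, y(., y0, u)) with u a control and y(t, y0, u) in Y for t in I.
   Under the Lipschitz hypothesis on f, the second component is determined by
   the first. *)
Definition admissible f Y (I : set R) (y0 : 'cV[R]_m) : set ((R -> U) * (R -> 'cV[R]_m)) :=
  [set p | [/\ control p.1, solution f y0 p.1 p.2 & forall t, I t -> Y (p.2 t)]].

Definition Vavg f k Y (T : R) (y0 : 'cV[R]_m) : \bar R :=
  ((T^-1)%:E * ereal_inf
    [set \int[leb]_(t in `[0%R, T]) (k (p.2 t) (p.1 t))%:E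
      | p in admissible f Y `[0%R, T] y0])%E.

Definition hdisc f k Y (l : R) (y0 : 'cV[R]_m) : \bar R :=
  (l%:E * ereal_inf
    [set \int[leb]_(t in `[0%R, +oo[) (expR (- l * t) * k (p.2 t) (p.1 t))%:E
      | p in admissible f Y `[0%R, +oo[ y0])%E.

Definition grad (psi : 'cV[R]_m -> R) (x : 'cV[R]_m) : 'rV[R]_m :=
  \row_i 'D_(delta_mx i 0) psi x.

Definition C1 (psi : 'cV[R]_m -> R) : Prop :=
  (forall x, differentiable psi x) /\ continuous (grad psi).

Definition dual_feasible f k Y (y0 : 'cV[R]_m) (mu : R) (psi eta : 'cV[R]_m -> R) : Prop :=
  [/\ C1 psi, C1 eta & forall x v, Y x ->
    0 <= k x v + (psi y0 - psi x) + (grad eta x *m f x v) 0 0 - mu /\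
    0 <= (grad psi x *m f x v) 0 0].

Definition dstar f k Y (y0 : 'cV[R]_m) : \bar R :=
  ereal_sup [set t.1.1%:E | t in
    [set t : R * ('cV[R]_m -> R) * ('cV[R]_m -> R) |
      dual_feasible f k Y y0 t.1.1 t.1.2 t.2]].

End control_system.

(* Main.v *)
(* Let (mu, psi, eta) be dual feasible and let y be a trajectory that stays in Y.
   Since d/dt psi(y) >= 0, psi(y(t)) >= psi(y0), so the first dual constraint
   gives k + d/dt eta(y) - mu >= 0 along y. Integrating this against e^(-l t)
   on [0, T], l >= 0, bounds the integral of e^(-l t) (k - mu) from below by
   -2 sup_Y |eta|, uniformly in T and l; dividing by T with l = 0, or letting
   T -> oo and multiplying by l, yields the two inequalities.

   The trajectory is only absolutely continuous. The chain rule needed is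
   obtained without almost everywhere differentiability: a function z that is
   the integral of a bounded function g is Lipschitz, hence
   phi(z(t)) - int_0^t phi'(z) g has increments o(|t - t0|) at every t0, and so
   is constant. *)

Require Import Defs.
From HB Require Import structures.
From mathcomp Require Import all_boot all_order all_algebra.
From mathcomp Require Import all_classical all_reals all_analysis.
From mathcomp Require Import measurable_realfun ring lra.

Set Implicit Arguments.
Unset Strict Implicit.
Unset Printing Implicit Defensive.

Import Order.TTheory GRing.Theory Num.Theory.
Import numFieldNormedType.Exports.

Local Open Scope classical_set_scope.
Local Open Scope ring_scope.

(** * Intervals and integrals for the completed Lebesgue measure *)

Section completed_lebesgue.
Context {R : realType}.
Local Notation mu := (@completed_lebesgue_measure R).
Implicit Types (g : R -> R) (a b : R).

Lemma measurable_itv_leb (i : interval R) :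
  measurable ([set` i] : set (lebesgueType R)).
Proof. by apply: sub_caratheodory; exact: measurable_itv. Qed.

Lemma leb_itvoc a b : a <= b -> mu `]a, b]%classic = (b - a)%:E.
Proof.
move=> ab.
(* The completed measure is the same set function as [lebesgue_measure], on a larger sigma-algebra,
   so the value transfers by conversion. *)
have : @lebesgue_measure R `]a, b]%classic = (b - a)%:E.
  rewrite lebesgue_measure_itv/= lte_fin; case: ltP => [|ba]; first by rewrite EFinB.
  by have -> : a = b; [apply/eqP; rewrite eq_le ab ba|rewrite subrr].
exact.
Qed.

Lemma leb_itvcc_lty a b : (mu `[a, b]%classic < +oo)%E.
Proof.
have : (@lebesgue_measure R `[a, b]%classic < +oo)%E.
  by rewrite lebesgue_measure_itv/= lte_fin; case: ifP => // _; rewrite ltry.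
exact.
Qed.

Lemma measurable_fun_leb (D : set R) g :
  measurable D -> measurable_fun D g ->
  measurable_fun (D : set (lebesgueType R)) g.
Proof. by move=> mD mg _ B mB; apply: sub_caratheodory; exact: mg. Qed.

Lemma within_continuous_measurable_leb (i : interval R) g :
  {within [set` i], continuous g} ->
  measurable_fun ([set` i] : set (lebesgueType R)) g.
Proof.
move=> cg; apply: measurable_fun_leb; first exact: measurable_itv.
by apply: subspace_continuous_measurable_fun => //; exact: measurable_itv.
Qed.

Lemma bounded_integrable_leb a b g (A : set (lebesgueType R)) M :
  measurable A -> A `<=` `[a, b] -> measurable_fun A g ->
  (forall s, A s -> `|g s| <= M) -> mu.-integrable A (EFin \o g).
Proof.
move=> mA Aab mg gM; apply: measurable_bounded_integrable => //.
  apply: (@le_lt_trans _ _ (mu `[a, b]%classic)); last exact: leb_itvcc_lty.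
  by apply: le_measure => //; rewrite ?inE//; exact: measurable_itv_leb.
exists M; split; first exact: num_real.
by move=> N MN x /gM gxM; apply: le_trans gxM _; exact: ltW.
Qed.

Lemma normr_Rintegral_leb_le a b g M : a <= b ->
  measurable_fun (`]a, b]%classic : set (lebesgueType R)) g ->
  (forall s, s \in `]a, b] -> `|g s| <= M) ->
  `|\int[mu]_(s in `]a, b]) g s| <= M * (b - a).
Proof.
move=> ab mg gM.
have ig : mu.-integrable `]a, b] (EFin \o g).
  apply: (@bounded_integrable_leb a b _ _ M) => //.
    exact: measurable_itv_leb.
  by apply: subset_itvr; rewrite bnd_simp.
have mI := @measurable_itv_leb `]a, b].
apply: le_trans (le_normr_Rintegral mI ig) _.
have -> : M * (b - a) = \int[mu]_(s in `]a, b]) M.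
  rewrite Rintegral_cst//; congr (_ * _).
  exact: (esym (congr1 fine (leb_itvoc ab))).
apply: le_Rintegral => //.
- exact: integrable_norm.
- apply: (@bounded_integrable_leb a b _ _ `|M|) => //.
  by apply: subset_itvr; rewrite bnd_simp.
Qed.

(** A singleton is null and every function is measurable on it, so [g] may be arbitrary. This gives
    the initial values of trajectories and primitives. *)
Lemma Rintegral_leb_itv1 a g : \int[mu]_(s in `[a, a]) g s = 0.
Proof.
have mu0 : mu `[a, a]%classic = 0%E.
  have : @lebesgue_measure R `[a, a]%classic = 0%E.
    by rewrite lebesgue_measure_itv/= ltxx.
  exact.
rewrite /Rintegral (null_set_integral _ _ mu0)//; first exact: measurable_itv_leb.
by rewrite set_itv1; exact: measurable_fun_set1.
Qed.

End completed_lebesgue.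

(** * Constancy from vanishing increments *)

Section calculus.
Context {R : realType}.
Implicit Types (F c : R -> R).

(** As [e] is arbitrary, the increment bound yields both derivative 0 at interior points and
    continuity up to the endpoints; the mean value theorem concludes. *)
Lemma incr_small_constant F (T : R) : 0 <= T ->
  (forall t0, t0 \in `[0, T] -> forall e, 0 < e ->
    \forall t \near t0, t \in `[0, T] -> `|F t - F t0| <= e * `|t - t0|) ->
  F T = F 0.
Proof.
move=> T0 HF.
have [||c _ FE] := @MVT_segment R F (cst 0) 0 T T0.
- move=> x xT.
  have xT' : x \in `[0, T] by apply: subset_itv_oo_cc.
  have cv : h^-1 *: ((F \o shift x) (h *: 1) - F x) @[h --> 0^'] --> 0.
    apply/cvgr0Pnorm_le => e e0.
    have := HF x xT' e e0.
    have : \forall t \near x, t \in `[0, T].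
      have : \forall t \near x, t \in `]0, T[ by exact: near_in_itvoo.
      by apply: filterS => t; exact: subset_itv_oo_cc.
    move=> /nbhs_ballP[d1 /= d10 H1] /nbhs_ballP[d2 /= d20 H2].
    near=> h.
    have hn0 : h != 0 by near: h; exact: nbhs_dnbhs_neq.
    have hd1 : ball x d1 (h + x).
      rewrite /ball/= opprD addrCA subrr addr0 normrN.
      by near: h; exact: dnbhs0_lt.
    have hd2 : ball x d2 (h + x).
      rewrite /ball/= opprD addrCA subrr addr0 normrN.
      by near: h; exact: dnbhs0_lt.
    have := H2 _ hd2 (H1 _ hd1).
    rewrite /= addrK /GRing.scale/= mulr1 normrM normfV => le.
    by rewrite ler_pdivrMl ?normr_gt0// mulrC.
  apply: DeriveDef; first by apply/cvg_ex; exists 0.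
  exact/cvg_lim.
- apply/subspace_continuousP => x xT.
  apply/cvgrPdist_le => e e0.
  (* Increments satisfy [|t - t0| <= T <= 1 + T]; the added 1 keeps the divisor positive when
     [T = 0]. *)
  have e1 : 0 < e / (1 + T) by rewrite divr_gt0// ltr_pwDl.
  have := HF x xT _ e1.
  apply: filterS => t H /= tT.
  rewrite distrC (le_trans (H tT))// mulrAC ler_pdivrMr ?ltr_pwDl//.
  rewrite ler_pM2l//.
  move: xT tT; rewrite /= !in_itv/= => /andP[? ?] /andP[? ?].
  by rewrite ler_norml; apply/andP; split; lra.
by apply/eqP; rewrite -subr_eq0 FE mul0r.
Unshelve. all: by end_near. Qed.

End calculus.

(** * Calculus of integrals of bounded measurable functions *)

(** [z] is Lipschitz with density [g]. No pointwise derivative is required, because the velocity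
    along a measurable control need not be continuous. *)
Definition primitive {R : realType} (T : R) (z g : R -> R) : Prop :=
  [/\ measurable_fun (`[0, T]%classic : set (lebesgueType R)) g,
      exists M, forall s, s \in `[0, T] -> `|g s| <= M &
      forall t, t \in `[0, T] ->
        z t = z 0 + \int[@completed_lebesgue_measure R]_(s in `[0, t]) g s].

Section primitive.
Context {R : realType} (T : R).
Local Notation mu := (@completed_lebesgue_measure R).
Implicit Types (z g c H : R -> R) (t a b : R).

Lemma primitive_integrable z g t : primitive T z g -> t \in `[0, T] ->
  mu.-integrable `[0, t] (EFin \o g).
Proof.
move=> [mg [M gM] _]; rewrite in_itv/= => /andP[t0 tT].
have sub : `[0, t] `<=` `[0, T] by apply: subset_itvl; rewrite bnd_simp.
apply: (@bounded_integrable_leb _ 0 T _ _ M) => //.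
- exact: measurable_itv_leb.
- by apply: measurable_funS mg => //; exact: measurable_itv_leb.
- by move=> s /sub; exact: gM.
Qed.

Lemma primitive0 : primitive T (fun=> 0) (fun=> 0).
Proof.
split; first exact: measurable_cst.
  by exists 0 => s _; rewrite normr0.
move=> t _; rewrite Rintegral_cst ?mul0r ?addr0//.
exact: measurable_itv_leb.
Qed.

Lemma primitiveD z1 g1 z2 g2 : primitive T z1 g1 -> primitive T z2 g2 ->
  primitive T (fun t => z1 t + z2 t) (fun t => g1 t + g2 t).
Proof.
move=> p1 p2.
have [[mg1 [M1 gM1] e1] [mg2 [M2 gM2] e2]] := (p1, p2).
split; first exact: measurable_funD.
  exists (M1 + M2) => s sT; rewrite (le_trans (ler_normD _ _))//.
  by rewrite lerD ?gM1 ?gM2.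
move=> t tT; have i1 := primitive_integrable p1 tT.
have i2 := primitive_integrable p2 tT.
by rewrite (RintegralD (measurable_itv_leb _) i1 i2) (e1 t tT) (e2 t tT) addrACA.
Qed.

Lemma primitiveZ r z g : primitive T z g ->
  primitive T (fun t => r * z t) (fun t => r * g t).
Proof.
move=> p; have [mg [M gM] e] := p; split.
- by apply: measurable_funM => //; exact: measurable_cst.
- by exists (`|r| * M) => s sT; rewrite normrM ler_wpM2l ?gM.
move=> t tT; have i1 := primitive_integrable p tT.
by rewrite (RintegralZl _ (measurable_itv_leb _) i1) (e t tT) mulrDr.
Qed.

Lemma primitiveB z1 g1 z2 g2 : primitive T z1 g1 -> primitive T z2 g2 ->
  primitive T (fun t => z1 t - z2 t) (fun t => g1 t - g2 t).
Proof.
move=> p1 /(primitiveZ (-1)) p2; have := primitiveD p1 p2.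
by under eq_fun do rewrite mulN1r; under [X in primitive T _ X]eq_fun do rewrite mulN1r.
Qed.

Lemma primitive_sum (I : Type) (r : seq I) (z g : I -> R -> R) :
  (forall i, primitive T (z i) (g i)) ->
  primitive T (fun t => \sum_(i <- r) z i t) (fun t => \sum_(i <- r) g i t).
Proof.
move=> p; elim: r => [|i r IH].
  under eq_fun do rewrite big_nil.
  by under [X in primitive T _ X]eq_fun do rewrite big_nil; exact: primitive0.
under eq_fun do rewrite big_cons.
under [X in primitive T _ X]eq_fun do rewrite big_cons.
exact: primitiveD.
Qed.

Lemma primitive_incr z g a b : primitive T z g -> 0 <= a -> a <= b -> b <= T ->
  z b - z a = \int[mu]_(s in `]a, b]) g s.
Proof.
move=> p a0 ab bT.
have aT : a \in `[0, T] by rewrite in_itv/= a0 (le_trans ab).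
have bT' : b \in `[0, T] by rewrite in_itv/= bT (le_trans a0).
have [_ _ e] := p.
have U : `[0, b]%classic = `[0, a] `|` `]a, b].
  by rewrite -itv_bndbnd_setU// bnd_simp.
rewrite (e b)// (e a)// U Rintegral_setU.
- lra.
- exact: measurable_itv_leb.
- exact: measurable_itv_leb.
- by rewrite -U; exact: primitive_integrable p bT'.
apply/disj_setPS => s [/=]; rewrite !in_itv/= => /andP[_ sa] /andP[].
by rewrite ltNge sa.
Qed.

Lemma primitive_incr_le z g a b M : primitive T z g ->
  0 <= a -> a <= b -> b <= T ->
  (forall s, s \in `]a, b] -> `|g s| <= M) -> `|z b - z a| <= M * (b - a).
Proof.
move=> p a0 ab bT gM; rewrite (primitive_incr p)//.
apply: normr_Rintegral_leb_le => //.
have [mg _ _] := p; apply: measurable_funS mg.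
- exact: measurable_itv_leb.
- by apply: subset_itvScc; rewrite bnd_simp.
Qed.

Lemma primitive_lipschitz z g : primitive T z g -> exists2 M, 0 <= M &
  forall a b, a \in `[0, T] -> b \in `[0, T] -> `|z b - z a| <= M * `|b - a|.
Proof.
move=> p; have [_ [M gM] _] := p.
have gM' s : s \in `[0, T] -> `|g s| <= `|M|.
  by move=> /gM /le_trans; apply; exact: ler_norm.
(* The absolute value secures nonnegativity even if [[0, T]] is empty, where [M] is
   unconstrained. *)
exists `|M| => // a b.
wlog ab : a b / a <= b.
  move=> W aT bT; have [ab|/ltW ba] := leP a b; first exact: W.
  by rewrite distrC (distrC b); exact: W.
rewrite !in_itv/= => /andP[a0 aT] /andP[b0 bT].
rewrite [`|b - a|]ger0_norm ?subr_ge0//.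
apply: (primitive_incr_le p) => // s /andP[as_ sb].
move: as_ sb; rewrite !bnd_simp => as_ sb.
by apply: gM'; rewrite in_itv/= (le_trans a0 (ltW as_)) (le_trans sb bT).
Qed.

Lemma primitive_Rintegral g :
  measurable_fun (`[0, T]%classic : set (lebesgueType R)) g ->
  (exists M, forall s, s \in `[0, T] -> `|g s| <= M) ->
  primitive T (fun t => \int[mu]_(s in `[0, t]) g s) g.
Proof.
move=> mg Mg; by split => // t _; rewrite Rintegral_leb_itv1 add0r.
Qed.

Lemma within_itv_continuous_near c t0 e : {within `[0, T], continuous c} ->
  t0 \in `[0, T] -> 0 < e ->
  \forall t \near t0, t \in `[0, T] -> `|c t - c t0| <= e.
Proof.
move=> /subspace_continuousP cc t0T e0.
have /cvgrPdist_le /(_ e e0) := cc t0 t0T.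
by apply: filterS => t; rewrite distrC; exact.
Qed.

Lemma within_itv_continuous_bounded c : {within `[0, T], continuous c} ->
  exists M, forall t, t \in `[0, T] -> `|c t| <= M.
Proof.
move=> cc.
have cp : compact (c @` `[0, T]).
  by apply: continuous_compact => //; exact: segment_compact.
have [M [_ HM]] := compact_bounded cp.
(* [compact_bounded] provides the bound for every number strictly above [M]. *)
exists (M + 1) => t tT; apply: (HM (M + 1)); first by rewrite ltrDl.
by exists t.
Qed.

(* [c i t0] plays the role of the partial derivative of [H] with respect to
   [z i] at time [t0]: depending on [H] this is the chain rule, the product
   rule, or the fundamental theorem of calculus. *)
Lemma primitive_comp (I : finType) (z g c : I -> R -> R) H :
  (forall i, primitive T (z i) (g i)) ->
  (forall i, {within `[0, T], continuous (c i)}) ->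
  (forall t0, t0 \in `[0, T] -> forall e, 0 < e -> \forall t \near t0,
    t \in `[0, T] ->
    `|H t - H t0 - \sum_i c i t0 * (z i t - z i t0)| <= e * `|t - t0|) ->
  primitive T H (fun s => \sum_i c i s * g i s).
Proof.
move=> p cc HH.
pose w s := \sum_i c i s * g i s.
have [M HM] : exists M : I -> R, forall i s, s \in `[0, T] -> `|g i s| <= M i.
  have /choice[M HM] : forall i, exists M, forall s, s \in `[0, T] -> `|g i s| <= M.
    by move=> i; have [_ HM _] := p i.
  by exists M.
have mw : measurable_fun (`[0, T]%classic : set (lebesgueType R)) w.
  apply: measurable_sum => i; apply: measurable_funM.
    exact: within_continuous_measurable_leb.
  by have [] := p i.
have bw : exists K, forall s, s \in `[0, T] -> `|w s| <= K.
  have /choice[K HK] : forall i, exists K, forall s, s \in `[0, T] -> `|c i s| <= K.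
    by move=> i; exact: within_itv_continuous_bounded.
  exists (\sum_i K i * M i) => s sT; rewrite (le_trans (ler_norm_sum _ _ _))//.
  by apply: ler_sum => i _; rewrite normrM ler_pM// ?HK ?HM.
have pW := primitive_Rintegral mw bw.
split => // t tT.
pose W s := \int[mu]_(x in `[0, s]) w x.
move: (tT); rewrite in_itv/= => /andP[t0 tleT].
have W0 : W 0 = 0.
  have [_ _ e] := pW; have := e 0; rewrite in_itv/= lexx (le_trans t0)//.
  by rewrite -/(W 0) => /(_ isT) /eqP; rewrite -subr_eq subrr => /eqP.
suff: H t - W t = H 0 - W 0.
  by rewrite W0 subr0 /W => /eqP; rewrite subr_eq => /eqP.
(* [W] is the integral of the candidate density [w]. It remains to see that [H - W] has increments
   [o(|r - r0|)] at each [r0]; half of [e] goes to the linearization error of [H], half to [W]. *)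
apply: (@incr_small_constant R (fun s => H s - W s)) => // r0 r0t e e0.
have sub r : r \in `[0, t] -> r \in `[0, T].
  by apply: subset_itvl; rewrite bnd_simp.
have r0T := sub _ r0t.
have M0 : 0 <= \sum_i M i.
  by apply: sumr_ge0 => i _; apply: le_trans (HM i r0 r0T).
(* If every coefficient [c i] oscillates by at most [e1] around [r0], then weighting by the bounds
   [M i] on the densities gives a total of at most [e / 2]. *)
pose e1 := e / 2 / (1 + \sum_i M i).
have e10 : 0 < e1 by rewrite !divr_gt0// ltr_pwDl.
have e1M : e1 * (\sum_i M i) <= e / 2.
  by rewrite mulrAC ler_pdivrMr ?ltr_pwDl// ler_pM2l ?divr_gt0// lerDr.
have /nbhs_ballP[d1 /= d10 H1] := HH r0 r0T (e / 2) ltac:(by rewrite divr_gt0).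
have : \forall s \near r0, forall i, s \in `[0, T] -> `|c i s - c i r0| <= e1.
  apply: (@filter_forall _ _ (fun i s => s \in `[0, T] -> `|c i s - c i r0| <= e1)
    (nbhs r0) _).
  by move=> i; exact: within_itv_continuous_near.
move=> /nbhs_ballP[d2 /= d20 H2].
near=> r => rt.
have rT := sub _ rt.
have rd1 : ball r0 d1 r by near: r; exact: nbhsx_ballx.
have rd2 : ball r0 d2 r by near: r; exact: nbhsx_ballx.
(* Freezing the coefficients at [r0] leaves a function [D] with density
   [\sum_i (c i s - c i r0) * g i s]. This is at most [e / 2] in absolute value near [r0], so [D] is
   [e / 2]-Lipschitz there. *)
pose D s := W s - \sum_i c i r0 * z i s.
have pD : primitive T D (fun s => w s - \sum_i c i r0 * g i s).
  by apply: primitiveB => //; apply: primitive_sum => i; exact: primitiveZ.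
have HD : `|D r - D r0| <= e / 2 * `|r - r0|.
  have loc a b : a \in `[0, T] -> b \in `[0, T] -> a <= b ->
      ball r0 d2 a -> ball r0 d2 b -> `|D b - D a| <= e / 2 * (b - a).
    rewrite !in_itv/= => /andP[a0 aT] /andP[b0 bT] ab rda rdb.
    apply: (primitive_incr_le pD) => // s; rewrite in_itv/= => /andP[as_ sb].
    have sT : s \in `[0, T].
      by rewrite in_itv/= (le_trans a0 (ltW as_)) (le_trans sb bT).
    have sd : ball r0 d2 s.
      move: rda rdb; rewrite /ball/= !ltr_distl => /andP[? ?] /andP[? ?].
      by apply/andP; split; lra.
    rewrite /w -sumrB (le_trans (ler_norm_sum _ _ _))//.
    apply: le_trans e1M; rewrite mulr_sumr; apply: ler_sum => i _.
    by rewrite -mulrBl normrM ler_pM// ?HM ?H2.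
  have r0d : ball r0 d2 r0 by exact: ballxx.
  have [rr0|/ltW r0r] := leP r r0.
    by rewrite distrC (distrC r) (ger0_norm (_ : 0 <= r0 - r)) ?subr_ge0//; exact: loc.
  by rewrite (ger0_norm (_ : 0 <= r - r0)) ?subr_ge0//; exact: loc.
have := H1 _ rd1 rT.
(* The increment of [H - W] is the linearization error of [H] minus the increment of [D]. *)
have -> : H r - W r - (H r0 - W r0) =
    (H r - H r0 - \sum_i c i r0 * (z i r - z i r0)) - (D r - D r0).
  rewrite /D; under eq_bigr do rewrite mulrBr.
  rewrite sumrB; ring.
move=> K; apply: le_trans (ler_normB _ _) _.
rewrite (_ : e * _ = e / 2 * `|r - r0| + e / 2 * `|r - r0|) ?lerD//; lra.
Unshelve. all: by end_near. Qed.

End primitive.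

(** * Differentiable functions and the fundamental theorem of calculus *)

Lemma differentiable_near {R : realType} {V W : normedModType R} (phi : V -> W)
    (x : V) (e : R) : differentiable phi x -> 0 < e ->
  \forall v \near x, `|phi v - phi x - 'd phi x (v - x)| <= e * `|v - x|.
Proof.
move=> dphi e0.
have /eqaddoP/(_ e e0) := diff_locally dphi.
move=> /nbhs_ballP[d /= d0 Hd]; apply/nbhs_ballP; exists d => //= v xv.
have /Hd : ball 0 d (v - x) by move: xv; rewrite -!ball_normE/= sub0r normrN distrC.
by rewrite /= !fctE /= subrK opprD addrA.
Qed.

Section differentiation.
Context {R : realType} (T : R).

(** This is [primitive_comp] with the single inner function [id], whose density is 1. *)
Lemma primitive_derive1 (H c : R -> R) : (forall t : R, is_derive t 1 H (c t)) ->
  continuous c -> primitive T H c.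
Proof.
move=> Hc cc.
have pid : primitive T id (cst 1).
  split; first exact: measurable_cst.
    by exists 1 => s _; rewrite normr1.
  move=> t; rewrite in_itv/= => /andP[t0 tT].
  rewrite Rintegral_cst ?mul1r; last exact: measurable_itv_leb.
  have : @lebesgue_measure R `[0, t]%classic = t%:E.
    rewrite lebesgue_measure_itv/= lte_fin sube0; by case: ltgtP t0 => // <-.
  by move=> /(congr1 fine)/= E; rewrite add0r; exact: esym E.
have := @primitive_comp R T 'I_1 (fun=> id) (fun=> cst 1) (fun=> c) H.
rewrite (_ : (fun s => \sum_(i < 1) c s * cst 1 s) = c); last first.
  by apply/funext => s; rewrite big_ord1 mulr1.
apply => //; first by move=> _; exact: continuous_subspaceT.
move=> t0 _ e e0; have dH : differentiable H t0.
  by apply/derivable1_diffP; exact: ex_derive.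
have := differentiable_near dH e0; apply: filterS => t + _.
by rewrite big_ord1 diff1E// derive1E derive_val /GRing.scale/= mulrC.
Qed.

End differentiation.

(** * Measurability of integrands along a controlled trajectory *)

Section measurability.
Context {R : realType} {m : nat} {U : metricType R}.

(* Sampling [y] on the grid of mesh [1 / (n + 1)] reduces the claim to functions
   [G (x, u s)] with [x] fixed, whose preimages of open sets are preimages by
   [u] of open sets; this avoids the Borel sets of the product. *)
Lemma measurable_control_trajectory (G : 'cV[R]_m * U -> R) (u : R -> U)
    (y : R -> 'cV[R]_m) :
  continuous G -> control u -> {within `[0, +oo[, continuous y} ->
  measurable_fun (`[0, +oo[%classic : set (lebesgueType R)) (fun s => G (y s, u s)).
Proof.
move=> cG cu cy.
(* For [s >= 0], this is the largest grid point not exceeding [s]. *)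
pose tt n (s : R) : R := (Num.truncn (s * n.+1%:R))%:R / n.+1%:R.
refine (measurable_fun_cvg (T := lebesgueType R)
  (h := fun n s => G (y (tt n s), u s)) _ _).
  move=> n.
  (* The half-open cells cover the half-line, and [tt n] is constant on each of them. *)
  pose E k := `[k%:R / n.+1%:R, k.+1%:R / n.+1%:R[%classic : set (lebesgueType R).
  have EE k s : E k s -> 0 <= s /\ Num.truncn (s * n.+1%:R) = k.
    rewrite /E/= in_itv/= => /andP[s1 s2].
    have s0 : 0 <= s by apply: le_trans s1; rewrite divr_ge0.
    split => //; apply: truncn_def.
    by rewrite -ler_pdivrMr// -ltr_pdivlMr// s1.
  have -> : `[0, +oo[%classic = \bigcup_k E k.
    apply/seteqP; split=> s /=.
      rewrite in_itv/= andbT => s0.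
      exists (Num.truncn (s * n.+1%:R)) => //.
      rewrite /E/= in_itv/= ler_pdivrMr// ltr_pdivlMr//.
      by rewrite truncn_itv// mulr_ge0.
    by move=> [k _ /EE[s0 _]]; rewrite in_itv/= s0.
  apply/measurable_fun_bigcup => [k|k]; first exact: measurable_itv_leb.
  pose x := y (k%:R / n.+1%:R).
  refine (eq_measurable_fun (fun s : lebesgueType R => G (x, u s)) _ _).
    by move=> s; rewrite inE => /EE[_ sk]; rewrite /tt sk.
  refine (measurability _ (RGenOpens.measurableE R) _).
  move=> _ [_ [a [b ->] <-]].
  pose O := (fun v => G (x, v)) @^-1` `]a, b[%classic.
  have oO : open O.
    apply: open_comp; last exact: interval_open.
    move=> v _; apply: (@continuous_comp _ _ _ (fun v => (x, v)) G); last exact: cG.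
    refine (cvg_pair (G := nbhs x) (H := nbhs v) _ _); [exact: cvg_cst|exact: cvg_id].
  (* Inserting the half-line, which contains [E k], produces the set whose measurability [control]
     asserts. *)
  have -> : E k `&` (fun s => G (x, u s)) @^-1` `]a, b[ =
      E k `&` (`[0, +oo[ `&` u @^-1` O).
    apply/seteqP; split=> s [Es Gs]; split => //=.
      by split => //; have [s0 _] := EE _ _ Es; rewrite /= in_itv/= s0.
    by case: Gs.
  by apply: measurableI; [exact: measurable_itv_leb|exact: cu].
move=> s s0.
have tts : tt n s @[n --> \oo] --> s.
  move: s0; rewrite /= in_itv/= andbT => s0.
  apply/cvgrPdist_le => e e0.
  near=> n.
  have /andP[H1 H2] := truncn_itv (mulr_ge0 s0 (ler0n R n.+1)).
  move: H1 H2; rewrite -ler_pdivrMr// -ltr_pdivlMr// -/(tt n s) => H1.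
  rewrite -[(Num.truncn (s * n.+1%:R)).+1%:R]natr1 mulrDl -/(tt n s) mul1r => H2.
  have H3 : n.+1%:R^-1 <= e.
    by apply: ltW; near: n; exact: (near_infty_natSinv_lt (PosNum e0)).
  rewrite ger0_norm ?subr_ge0// lerBlDl (le_trans (ltW H2))// lerD2l.
  exact: H3.
have tt0 n : 0 <= tt n s by rewrite divr_ge0.
have yts : y (tt n s) @[n --> \oo] --> y s.
  (* Continuity of [y] holds only within the half-line, so the sample points must also be
     nonnegative. *)
  move/subspace_continuousP : cy => /(_ s s0) ys.
  apply: (@cvg_comp _ _ _ (tt ^~ s) y _ (within `[0, +oo[ (nbhs s)) _ _ ys).
  move=> A; rewrite /within/= => /tts; rewrite /nbhs/=.
  apply: filterS => n; apply; by rewrite /= in_itv/= tt0.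
apply: (@cvg_comp _ _ _ (fun n => (y (tt n s), u s)) G _ (nbhs (y s, u s))).
  refine (cvg_pair (G := nbhs (y s)) (H := nbhs (u s)) _ _) => //; exact: cvg_cst.
exact: cG.
Unshelve. all: by end_near. Qed.

End measurability.

(** * Product rule and chain rule along a trajectory *)

Section differentiation_along.
Context {R : realType} (T : R).
Local Notation mu := (@completed_lebesgue_measure R).

(** The partial derivative in one factor is the other factor, hence the coefficient [z (~~ b)]. The
    linearization error is the product of the two increments: one tends to 0 by continuity, the
    other is [O(|t - t0|)] by the Lipschitz bound. *)
Lemma primitiveM (z1 g1 z2 g2 : R -> R) :
  {within `[0, T], continuous z1} -> {within `[0, T], continuous z2} ->
  primitive T z1 g1 -> primitive T z2 g2 ->
  primitive T (fun t => z1 t * z2 t) (fun t => z2 t * g1 t + z1 t * g2 t).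
Proof.
move=> c1 c2 p1 p2.
pose z b := if b then z1 else z2; pose g b := if b then g1 else g2.
have := @primitive_comp R T bool z g (fun b => z (~~ b)) (fun t => z1 t * z2 t).
rewrite (_ : (fun s => \sum_i z (~~ i) s * g i s) =
             fun t => z2 t * g1 t + z1 t * g2 t); last first.
  by apply/funext => s; rewrite big_bool.
apply; [by case|by case|].
move=> t0 t0T e e0.
have [M M0 HM] := primitive_lipschitz p2.
have e1 : 0 < e / (1 + M) by rewrite divr_gt0// ltr_pwDl.
have := within_itv_continuous_near c1 t0T e1.
apply: filterS => t + tT => /(_ tT) Hz.
rewrite big_bool/= (_ : _ - _ = (z1 t - z1 t0) * (z2 t - z2 t0)); last by ring.
rewrite normrM.
apply: le_trans (ler_pM (normr_ge0 _) (normr_ge0 _) Hz (HM _ _ t0T tT)) _.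
rewrite mulrA ler_wpM2r// mulrAC ler_pdivrMr ?ltr_pwDl// ler_pM2l//; lra.
Qed.

(** The linearization error of [phi] is [o(|y t - y t0|)], which is [o(|t - t0|)] because the
    coordinates of [y] are Lipschitz. *)
Lemma primitive_C1 {m : nat} (y g : R -> 'cV[R]_m) (phi : 'cV[R]_m -> R) :
  C1 phi -> {within `[0, T], continuous y} ->
  (forall i, primitive T (fun t => y t i 0) (fun s => g s i 0)) ->
  primitive T (fun t => phi (y t)) (fun s => (grad phi (y s) *m g s) 0 0).
Proof.
move=> [dphi cphi] cy py.
have := @primitive_comp R T 'I_m (fun i t => y t i 0) (fun i s => g s i 0)
  (fun i s => grad phi (y s) 0 i) (fun t => phi (y t)).
rewrite (_ : (fun s => \sum_i grad phi (y s) 0 i * g s i 0) =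
             fun s => (grad phi (y s) *m g s) 0 0); last first.
  by apply/funext => s; rewrite mxE.
apply => //.
  move=> i; apply/subspace_continuousP => t tT.
  move/subspace_continuousP : cy => /(_ t tT) yt.
  apply: (@cvg_comp _ _ _ y (fun x => grad phi x 0 i) _ (nbhs (y t))) => //.
  apply: (@continuous_comp _ _ _ (grad phi) (fun A => A 0 i)); first exact: cphi.
  exact: coord_continuous.
move=> t0 t0T e e0.
have /choice[M HM] : forall i, exists M, 0 <= M /\ forall a b,
    a \in `[0, T] -> b \in `[0, T] -> `|y b i 0 - y a i 0| <= M * `|b - a|.
  by move=> i; have [M M0 HM] := primitive_lipschitz (py i); exists M.
(* Expanding [y t - y t0] in the standard basis turns the coordinate constants [M i] into a
   Lipschitz constant for [y] in norm. *)
pose K := \sum_i M i * `|delta_mx i 0 : 'cV[R]_m|.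
have sumE (x : 'cV[R]_m) : x = \sum_i x i 0 *: delta_mx i 0.
  by rewrite {1}[x]matrix_sum_delta; apply: eq_bigr => i _; rewrite big_ord1.
have K0 : 0 <= K by apply: sumr_ge0 => i _; rewrite mulr_ge0//; have [] := HM i.
have ylip t : t \in `[0, T] -> `|y t - y t0| <= K * `|t - t0|.
  move=> tT; rewrite [y t - y t0]sumE mulr_suml (le_trans (ler_norm_sum _ _ _))//.
  apply: ler_sum => i _; rewrite normrZ mulrAC ler_wpM2r// !mxE.
  by have [_] := HM i; exact.
have e1 : 0 < e / (1 + K) by rewrite divr_gt0// ltr_pwDl.
have /subspace_continuousP/(_ t0 t0T) yt := cy.
have : \forall t \near t0, t \in `[0, T] ->
    `|phi (y t) - phi (y t0) - 'd phi (y t0) (y t - y t0)|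
    <= e / (1 + K) * `|y t - y t0|.
  exact: yt _ (differentiable_near (dphi (y t0)) e1).
apply: filterS => t + tT => /(_ tT).
rewrite (_ : 'd phi (y t0) (y t - y t0) =
             \sum_i grad phi (y t0) 0 i * (y t i 0 - y t0 i 0)); last first.
  rewrite [y t - y t0 in LHS]sumE linear_sum; apply: eq_bigr => i _.
  by rewrite linearZ/= -deriveE// !mxE mulrC.
move=> /le_trans; apply; apply: le_trans (ler_wpM2l (ltW e1) (ylip _ tT)) _.
rewrite mulrA ler_wpM2r// mulrAC ler_pdivrMr ?ltr_pwDl// ler_pM2l//; lra.
Qed.

End differentiation_along.

(** * Bounds and densities along admissible pairs *)

Section dual_bound.
Context {R : realType} {m : nat} {U : metricType R}.
Local Notation mu := (@completed_lebesgue_measure R).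
Implicit Types (f : 'cV[R]_m -> U -> 'cV[R]_m) (Y : set 'cV[R]_m).
Implicit Types (p : (R -> U) * (R -> 'cV[R]_m)).

Lemma continuous_compact_setT_bounded (G : 'cV[R]_m * U -> R) Y :
  compact [set: U] -> compact Y -> continuous G ->
  exists2 K, 0 <= K & forall x v, Y x -> `|G (x, v)| <= K.
Proof.
move=> cU cY cG.
have cp : compact (G @` (Y `*` [set: U])).
  apply: continuous_compact; first exact: continuous_subspaceT.
  exact: compact_setX.
have [M [_ HM]] := compact_bounded cp.
exists `|M + 1| => // x v Yx.
apply: le_trans (ler_norm (M + 1)); apply: (HM (M + 1)); first by rewrite ltrDl.
by exists (x, v).
Qed.

Lemma admissible_measurable f Y (G : 'cV[R]_m * U -> R) I y0 p (J : interval R) :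
  continuous G -> admissible f Y I y0 p -> [set` J] `<=` `[0, +oo[ ->
  measurable_fun ([set` J] : set (lebesgueType R)) (fun s => G (p.2 s, p.1 s)).
Proof.
move=> cG [cu [cy _] _] J0.
apply: measurable_funS (measurable_control_trajectory cG cu cy) => //.
exact: measurable_itv_leb.
Qed.

(** The velocity is bounded since the trajectory stays in [Y] and [f] is bounded on the compact
    product of [Y] and [U]. *)
Lemma admissible_primitive f Y (T : R) y0 p :
  compact [set: U] -> compact Y ->
  continuous (fun q : 'cV[R]_m * U => f q.1 q.2) ->
  admissible f Y `[0, T] y0 p ->
  forall i, primitive T (fun t => p.2 t i 0) (fun s => f (p.2 s) (p.1 s) i 0).
Proof.
move=> cU cY cf adm i; have [cu [cy e] YT] := adm.
have cfi : continuous (fun q : 'cV[R]_m * U => f q.1 q.2 i 0).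
  move=> q; apply: (@continuous_comp _ _ _ (fun q : 'cV[R]_m * U => f q.1 q.2)
    (fun A : 'cV[R]_m => A i 0)); first exact: cf.
  exact: coord_continuous.
split.
- apply: (admissible_measurable cfi adm).
  by move=> s; rewrite /= !in_itv/= andbT => /andP[].
- have [K K0 HK] := continuous_compact_setT_bounded cU cY cfi.
  by exists K => s sT; apply: (HK (p.2 s) (p.1 s)); exact: YT.
move=> t; rewrite in_itv/= => /andP[t0 _].
by rewrite (e t t0) (e 0 (lexx _)) Rintegral_leb_itv1 addr0.
Qed.

End dual_bound.

(** * Monotone primitives and the lower bound from a dual feasible triple *)

Lemma primitive_ge0 {R : realType} (T t : R) z g : primitive T z g ->
  (forall s, s \in `[0, T] -> 0 <= g s) -> t \in `[0, T] -> z 0 <= z t.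
Proof.
move=> [_ _ e] g0 tT; rewrite (e t tT) lerDl; apply: Rintegral_ge0 => s st.
apply: g0; move: st tT; rewrite /= !in_itv/= => /andP[-> st] /andP[_ tT].
exact: le_trans tT.
Qed.

Lemma primitive_expR {R : realType} (T l : R) :
  primitive T (fun t => expR (- l * t)) (fun t => - l * expR (- l * t)).
Proof.
apply: primitive_derive1 => [t|t].
  by apply: is_derive_eq; rewrite /GRing.scale/= mulr1 mulrC.
apply: cvgM; first exact: cvg_cst.
apply: continuous_comp; last exact: continuous_expR.
by apply: cvgM; [exact: cvg_cst|exact: cvg_id].
Qed.

Section dual_lower_bound.
Context {R : realType} {m : nat} {U : metricType R}.
Local Notation leb := (@completed_lebesgue_measure R).
Implicit Types (f : 'cV[R]_m -> U -> 'cV[R]_m) (k : 'cV[R]_m -> U -> R).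
Implicit Types (Y : set 'cV[R]_m) (p : (R -> U) * (R -> 'cV[R]_m)).

(* [l = 0] covers the averaged criterion. *)
Lemma dual_feasible_lower_bound f k Y y0 mu psi eta :
  compact [set: U] -> compact Y ->
  continuous (fun q : 'cV[R]_m * U => f q.1 q.2) ->
  continuous (fun q : 'cV[R]_m * U => k q.1 q.2) ->
  Y y0 -> dual_feasible f k Y y0 mu psi eta ->
  exists B, forall (T l : R) p, 0 <= T -> 0 <= l ->
    admissible f Y `[0, T] y0 p ->
    mu * (\int[leb]_(s in `[0, T]) expR (- l * s)) - B <=
    \int[leb]_(s in `[0, T]) (expR (- l * s) * k (p.2 s) (p.1 s)).
Proof.
move=> cU cY cf ck Yy0 [Cpsi Ceta feas].
have ceta : continuous eta.
  by move=> x; apply: differentiable_continuous; have [] := Ceta.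
(* [B] bounds [|eta|] on [Y], with [eta] read as a function of the pair that ignores the control. *)
have [B B0 HB] := continuous_compact_setT_bounded cU cY
  (fun q : 'cV[R]_m * U => continuous_comp (@cvg_fst _ _ _ _ _) (ceta q.1)).
have [K K0 HK] := continuous_compact_setT_bounded cU cY ck.
(* One [B] bounds [eta y0] from below; the other is the value at time 0 of the corrector [B * a]
   introduced below. *)
exists (2 * B) => T l [u y] T0 l0 adm.
have [_ [cy ey] YT] := adm; rewrite /= in cy ey YT.
have y00 : y 0 = y0.
  by apply/colP => i; rewrite (ey 0 (lexx _)) Rintegral_leb_itv1 addr0.
have sub0T : `[0, T] `<=` `[0, +oo[ by apply: subset_itvl.
have cyT : {within `[0, T], continuous y} by exact: continuous_subspaceW cy.
have py := admissible_primitive cU cY cf adm; rewrite /= in py.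
have ppsi := primitive_C1 Cpsi cyT py.
have peta := primitive_C1 Ceta cyT py.
pose a t := expR (- l * t).
have pa : primitive T a (fun t => - l * a t) := primitive_expR T l.
have ca : {within `[0, T], continuous a}.
  apply: continuous_subspaceT => t.
  apply: continuous_comp; last exact: continuous_expR.
  by apply: cvgM; [exact: cvg_cst|exact: cvg_id].
have cetay : {within `[0, T], continuous (fun t => eta (y t))}.
  apply/subspace_continuousP => t tT.
  move/subspace_continuousP : cyT => /(_ t tT) yt.
  apply: (@cvg_comp _ _ _ y eta _ (nbhs (y t))) => //; exact: ceta.
have paeta := primitiveM ca cetay pa peta.
have ma := within_continuous_measurable_leb ca.
have [Ka HKa] := within_itv_continuous_bounded ca.
have pA := primitive_Rintegral ma (ex_intro _ Ka HKa).
have pq : primitive T (fun t => \int[leb]_(s in `[0, t]) (a s * k (y s) (u s)))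
                      (fun s => a s * k (y s) (u s)).
  apply: primitive_Rintegral.
    apply: measurable_funM => //.
    exact: (admissible_measurable ck adm).
  exists (Ka * K) => s sT; rewrite normrM ler_pM ?HKa//.
  by apply: HK; exact: YT.
have psi_ge t : t \in `[0, T] -> psi y0 <= psi (y t).
  move=> tT; rewrite -y00; apply: (primitive_ge0 ppsi) => // s sT.
  by have [] := feas (y s) (u s) (YT s sT).
have eta_le t : t \in `[0, T] -> `|eta (y t)| <= B.
  by move=> tT; apply: (HB (y t) (u t)); exact: YT.
have a0 t : 0 <= a t by exact: expR_ge0.
have TT : T \in `[0, T] by rewrite in_itv/= T0 lexx.
have OT : 0 \in `[0, T] by rewrite in_itv/= T0 lexx.
(* The function [int a k - mu int a + a eta(y) - B a] is nondecreasing. Its density is [a (k + grad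
   eta f - mu) + l a (B - eta(y))]: the corrector [- B a] makes the term coming from the derivative
   of the weight nonnegative. Comparing times 0 and [T] gives the bound. *)
have := primitiveB pq
  (primitiveD (primitiveB (primitiveZ mu pA) paeta) (primitiveZ B pa)).
move=> /primitive_ge0 /(_ _ TT).
rewrite !Rintegral_leb_itv1 /a !mulr0 expR0 !mul1r mulr1 y00 -/a => H.
have {}H := H _.
have := eta_le T TT; have := eta_le 0 OT.
rewrite y00 !ler_norml => /andP[e1 _] /andP[_ e2].
have e3 : 0 <= a T * (B - eta (y T)) by rewrite mulr_ge0// subr_ge0.
suff /H{H} : forall s, s \in `[0, T] -> 0 <= a s * k (y s) (u s) -
     (mu * a s - (eta (y s) * (- l * a s) +
       a s * (grad eta (y s) *m f (y s) (u s)) 0 0) + B * (- l * a s)).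
  by rewrite /= -/a -/(a T) => H; lra.
move=> s sT.
have [/= h1 _] := feas (y s) (u s) (YT s sT).
have h2 := psi_ge s sT.
have /ler_normlP[_ h3] := eta_le s sT.
rewrite (_ : _ - _ =
  a s * (k (y s) (u s) + (grad eta (y s) *m f (y s) (u s)) 0 0 - mu) +
  l * a s * (B - eta (y s))); last by ring.
by rewrite addr_ge0// mulr_ge0 ?mulr_ge0// ?subr_ge0//; lra.
Qed.

End dual_lower_bound.

(** * Lower limits of the two optimal values *)

(** The lower limit is a supremum of infima over the members of [F], and the set where [h] is at
    least [c - e] is such a member. *)
Lemma le_limf_einf {R : realType} (F : set_system R) {FF : ProperFilter F}
    (h : R -> \bar R) (c : R) :
  (forall e, 0 < e -> \forall x \near F, ((c - e)%:E <= h x)%E) ->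
  (c%:E <= limf_einf h F)%E.
Proof.
move=> H; apply/lee_addgt0Pr => e e0; rewrite limf_einfE -leeBlDr// -EFinB.
apply: le_ereal_sup_tmp.
exists (ereal_inf (h @` [set x | ((c - e)%:E <= h x)%E])).
  by exists [set x | ((c - e)%:E <= h x)%E] => //; exact: H.
by apply: le_ereal_inf_tmp => _ [x /= hx <-].
Qed.

Section main.
Context {R : realType} {m : nat} {U : metricType R}.
Local Notation leb := (@completed_lebesgue_measure R).
Implicit Types (f : 'cV[R]_m -> U -> 'cV[R]_m) (k : 'cV[R]_m -> U -> R).
Implicit Types (Y : set 'cV[R]_m) (p : (R -> U) * (R -> 'cV[R]_m)).

Lemma Rintegral_expR_leb (l T : R) : 0 < l -> 0 <= T ->
  \int[leb]_(s in `[0, T]) expR (- l * s) = l^-1 * (1 - expR (- l * T)).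
Proof.
move=> l0 T0.
have TT : T \in `[0, T] by rewrite in_itv/= T0 lexx.
have := primitiveZ (- l^-1) (primitive_expR T l).
rewrite (_ : (fun t => _ * (_ * _)) = fun t => expR (- l * t)); last first.
  by apply/funext => t; rewrite mulrA mulrNN mulVf ?mul1r ?gt_eqF.
move=> [_ _ /(_ _ TT)]; rewrite mulr0 expR0 => E; lra.
Qed.

Lemma Vavg_ge f k Y y0 mu psi eta :
  compact [set: U] -> compact Y ->
  continuous (fun q : 'cV[R]_m * U => f q.1 q.2) ->
  continuous (fun q : 'cV[R]_m * U => k q.1 q.2) ->
  Y y0 -> dual_feasible f k Y y0 mu psi eta ->
  exists B, forall T, 0 < T -> ((mu - B / T)%:E <= Vavg f k Y T y0)%E.
Proof.
move=> cU cY cf ck Yy0 feas.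
have [B HB] := dual_feasible_lower_bound cU cY cf ck Yy0 feas.
have [K K0 HK] := continuous_compact_setT_bounded cU cY ck.
exists B => T T0.
have -> : (mu - B / T)%:E = (T^-1%:E * (mu * T - B)%:E)%E.
  by rewrite -EFinM; congr EFin; field; rewrite gt_eqF.
apply: lee_wpmul2l; first by rewrite lee_fin invr_ge0 ltW.
apply: le_ereal_inf_tmp => _ [p adm <-].
(* Integrability makes the extended-real cost finite, so it can be compared with the real integral
   of the dual bound. *)
have ik : leb.-integrable `[0, T] (EFin \o (fun t => k (p.2 t) (p.1 t))).
  apply: (@bounded_integrable_leb _ 0 T _ _ K) => //.
  - exact: measurable_itv_leb.
  - apply: (admissible_measurable ck adm).
    by move=> s; rewrite /= !in_itv/= andbT => /andP[].
  - by move=> s sT; apply: HK; have [_ _] := adm; exact.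
rewrite -[leRHS]fineK; last exact: (integrable_fin_num (measurable_itv_leb _) ik).
rewrite lee_fin.
have := HB T 0 p (ltW T0) (lexx _) adm.
under eq_Rintegral do rewrite oppr0 mul0r expR0.
under [X in _ <= X -> _]eq_Rintegral do rewrite oppr0 mul0r expR0 mul1r.
rewrite Rintegral_cst; last exact: measurable_itv_leb.
have : @lebesgue_measure R `[0, T]%classic = T%:E.
  by rewrite lebesgue_measure_itv/= lte_fin T0 sube0.
by move=> /(congr1 fine)/= E; rewrite mul1r; move: E => ->.
Qed.

(** The dual bound on [[0, n + 1]] passes to the limit in [n]: the mass of [e^(-l t)] tends to
    [1 / l], and multiplying [mu / l - B] by [l] gives [mu - B * l]. The discounted cost is
    integrable, being dominated by [K * a]. *)
Lemma hdisc_ge f k Y y0 mu psi eta :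
  compact [set: U] -> compact Y ->
  continuous (fun q : 'cV[R]_m * U => f q.1 q.2) ->
  continuous (fun q : 'cV[R]_m * U => k q.1 q.2) ->
  Y y0 -> dual_feasible f k Y y0 mu psi eta ->
  exists B, forall l, 0 < l -> ((mu - B * l)%:E <= hdisc f k Y l y0)%E.
Proof.
move=> cU cY cf ck Yy0 feas.
have [B HB] := dual_feasible_lower_bound cU cY cf ck Yy0 feas.
have [K K0 HK] := continuous_compact_setT_bounded cU cY ck.
exists B => l l0.
have -> : (mu - B * l)%:E = (l%:E * (mu / l - B)%:E)%E.
  by rewrite -EFinM; congr EFin; field; rewrite gt_eqF.
apply: lee_wpmul2l; first by rewrite lee_fin ltW.
apply: le_ereal_inf_tmp => _ [p adm <-].
pose a t := expR (- l * t).
pose q t := k (p.2 t) (p.1 t).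
have a_ge0 t : 0 <= a t by exact: expR_ge0.
have qK t : 0 <= t -> `|q t| <= K.
  by move=> t0; apply: HK; have [_ _] := adm; apply; rewrite /= in_itv/= t0.
pose D : set (lebesgueType R) := `[0, +oo[%classic.
pose F n : set (lebesgueType R) := `[0, n.+1%:R]%classic.
have mD : measurable D by exact: measurable_itv_leb.
have mF n : measurable (F n) by exact: measurable_itv_leb.
have FD n : F n `<=` D by apply: subset_itvl.
have UF : D = \bigcup_n F n by rewrite /D itv0y_bigcup0S.
have ndF : nondecreasing_seq F.
  by move=> i j ij; apply/subsetPset/subset_itvl; rewrite bnd_simp ler_nat.
have ma : measurable_fun D a.
  apply: within_continuous_measurable_leb; apply: continuous_subspaceT => t.
  apply: continuous_comp; last exact: continuous_expR.
  by apply: cvgM; [exact: cvg_cst|exact: cvg_id].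
have mq : measurable_fun D q by exact: (admissible_measurable ck adm).
have ia n : leb.-integrable (F n) (EFin \o a).
  apply: (@bounded_integrable_leb _ 0 n.+1%:R _ _ 1) => //.
    exact: measurable_funS (FD n) ma.
  move=> s; rewrite /F/= in_itv/= => /andP[s0 _].
  by rewrite ger0_norm// -expR0 ler_expR mulNr oppr_le0 mulr_ge0// ltW.
have iaq n : leb.-integrable (F n) (EFin \o (fun t => a t * q t)).
  apply: (le_integrable (mF n) _ _ (integrableZl (mF n) K (ia n))).
    apply/measurable_EFinP; apply: measurable_funS (FD n) _ => //.
    exact: measurable_funM.
  move=> s /FD; rewrite /D/= in_itv/= andbT => s0.
  by rewrite lee_fin !normrM mulrC ler_wpM2r// (ger0_norm K0) qK.
have A_cvg : (\int[leb]_(t in F n) (a t)%:E @[n --> \oo] --> (l^-1)%:E)%E.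
  have an0 : a n.+1%:R @[n --> \oo] --> 0.
    apply/cvgr0Pnorm_le => e e0.
    have /cvgr0Pnorm_le/(_ e e0) [A [_ HA]] := @cvgr_expR R.
    near=> n; rewrite /a mulNr; apply: HA; rewrite -ltr_pdivrMl//.
    apply: (@lt_trans _ _ n%:R); last by rewrite ltr_nat.
    by near: n; exact: nbhs_infty_gtr.
  have -> : (fun n => \int[leb]_(t in F n) (a t)%:E)%E =
            EFin \o (fun n => l^-1 * (1 - a n.+1%:R)).
    apply/funext => n /=; rewrite -Rintegral_expR_leb//.
    exact: esym (fineK (integrable_fin_num (mF n) (ia n))).
  apply: cvg_EFin; first exact: nearW.
  rewrite -[X in _ --> X]mulr1 -[X in _ * X]subr0.
  by apply: cvgM; [exact: cvg_cst|apply: cvgB => //; exact: cvg_cst].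
(* Monotone convergence identifies the integral over the half-line with the limit of the explicit
   truncated integrals. *)
have AE : (\int[leb]_(t in D) (a t)%:E = (l^-1)%:E)%E.
  rewrite UF; apply: cvg_unique A_cvg => //.
  apply: ge0_nondecreasing_set_cvg_integral => //.
  - by move=> n; apply/measurable_EFinP; exact: measurable_funS (FD n) ma.
  - by move=> n t _; rewrite lee_fin.
have iaD : leb.-integrable D (EFin \o a).
  apply/integrableP; split; first exact/measurable_EFinP.
  under eq_integral do rewrite /= ger0_norm//.
  by rewrite AE ltry.
have iaqD : leb.-integrable D (EFin \o (fun t => a t * q t)).
  apply: (le_integrable mD _ _ (integrableZl mD K iaD)).
    by apply/measurable_EFinP; exact: measurable_funM.
  move=> s; rewrite /D/= in_itv/= andbT => s0.
  by rewrite lee_fin !normrM mulrC ler_wpM2r// (ger0_norm K0) qK.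
(* Shifting by [K * a] makes the integrand nonnegative, so that monotone
   convergence applies. *)
pose w t := a t * q t + K * a t.
have w_cvg : (\int[leb]_(t in F n) (w t)%:E @[n --> \oo] -->
              \int[leb]_(t in D) (w t)%:E)%E.
  rewrite UF; apply: ge0_nondecreasing_set_cvg_integral => //.
    move=> n; apply/measurable_EFinP; apply: measurable_funS (FD n) _ => //.
    by apply: measurable_funD; apply: measurable_funM.
  move=> n t /FD; rewrite /D/= in_itv/= andbT => /qK /ler_normlP[qt _].
  by rewrite lee_fin /w [a t * _]mulrC -mulrDl mulr_ge0//; lra.
have wE (E : set (lebesgueType R)) : measurable E ->
    leb.-integrable E (EFin \o (fun t => a t * q t)) ->
    leb.-integrable E (EFin \o a) ->
    (\int[leb]_(t in E) (w t)%:E =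
     (\int[leb]_(t in E) (a t * q t) + K * \int[leb]_(t in E) a t)%:E)%E.
  move=> mE i1 i2.
  have i3 : leb.-integrable E (EFin \o (fun t => K * a t)).
    exact: (integrableZl mE K i2).
  rewrite -RintegralZl// -RintegralD// [RHS]fineK//.
  exact: (integrable_fin_num mE (integrableD mE i1 i3)).
have -> : (\int[leb]_(t in D) (a t * q t)%:E = (\int[leb]_(t in D) (a t * q t))%:E)%E.
  exact: esym (fineK (integrable_fin_num mD iaqD)).
rewrite lee_fin.
have RAE : \int[leb]_(t in D) a t = l^-1 by rewrite /Rintegral AE.
move: A_cvg => /fine_cvg A_cvg.
move: w_cvg; rewrite (wE _ mD iaqD iaD) RAE => /fine_cvg w_cvg.
(* Adding [K / l], the integral of the shift, makes the right-hand side the limit in [w_cvg]; at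
   each [n] the shift cancels and the dual bound remains. *)
rewrite -(lerD2r (K * l^-1)).
apply: ler_cvg_to (cvgD (cvgB (cvgM (cvg_cst mu) A_cvg) (cvg_cst B))
                        (cvgM (cvg_cst K) A_cvg)) w_cvg _.
apply: nearW => n /=; rewrite wE//= lerD2r.
apply: HB => //; first exact: ltW.
have [cu sol Yp] := adm; split => // t nt; apply: Yp; exact: (FD n).
Unshelve. all: by end_near. Qed.

End main.

Theorem proposition3p1 (R : realType) (m : nat) (U : metricType R)
  (f : 'cV[R]_m -> U -> 'cV[R]_m) (k : 'cV[R]_m -> U -> R) (Y : set 'cV[R]_m)
  (U_compact : compact [set: U])
  (f_continuous : continuous (fun p : 'cV[R]_m * U => f p.1 p.2))
  (f_lipschitz : exists L : R, forall (u : U) (x y : 'cV[R]_m),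
     `|f x u - f y u| <= L * `|x - y|)
  (k_continuous : continuous (fun p : 'cV[R]_m * U => k p.1 p.2))
  (Y_nonempty : Y !=set0)
  (Y_compact : compact Y)
  (Y_regular : Y = closure Y°)
  (viable : forall y0, Y y0 -> admissible f Y `[0, +oo[ y0 !=set0) :
  forall y0, Y y0 ->
    (dstar f k Y y0 <= limf_einf (fun T : R => Vavg f k Y T y0) +oo%R)%E /\
    (dstar f k Y y0 <= limf_einf (fun l : R => hdisc f k Y l y0) 0^'+)%E.

Proof.
(* By definition of the supremum it suffices to treat one feasible triple, and then to bound the
   value by [mu - e] eventually. *)
move=> y0 Yy0; split; apply: ge_ereal_sup => _ [[[mu psi] eta] /= feas <-];
  apply: le_limf_einf => e e0.
- have [B HB] := Vavg_ge U_compact Y_compact f_continuous k_continuous Yy0 feas.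
  near=> T; have T0 : 0 < T by near: T; exact: nbhs_pinfty_gt.
  apply: le_trans (HB T T0); rewrite lee_fin lerD2l lerN2 ler_pdivrMr// mulrC.
  by rewrite -ler_pdivrMr// ltW//; near: T; exact: nbhs_pinfty_gt.
- have [B HB] := hdisc_ge U_compact Y_compact f_continuous k_continuous Yy0 feas.
  near=> l; have l0 : 0 < l by near: l; exact: nbhs_right_gt.
  apply: le_trans (HB l l0); rewrite lee_fin lerD2l lerN2.
  (* The sign of [B] is not known, so the threshold uses [1 + |B|], which is positive and at least
     [B]. *)
  have l1 : l < e / (1 + `|B|).
    by near: l; apply: nbhs_right_lt; rewrite divr_gt0// ltr_pwDl.
  move: l1; rewrite ltr_pdivlMr ?ltr_pwDl// => /ltW; apply: le_trans.
  by rewrite mulrC ler_wpM2l ?(ltW l0)// (le_trans (ler_norm B))// lerDr.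
Unshelve. all: by end_near. Qed.
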